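(* Let $K$ be a field, $P_0=K[x_1,\dots,x_m]$, $P=P_0[y_1,\dots,y_n]$ bigraded by $\deg x_i=(1,0)$, $\deg y_j=(0,1)$, and $P_+=(y_1,\dots,y_n)$. Let $f\in P$ be bihomogeneous and $R=P/fP$, and suppose that the $P_0$-module $H^n_{P_+}(R)_j$ has finite length for all $j$. Then $$\operatorname{reg} H^n_{P_+}(R)_{j-1}\ \ge\ \operatorname{reg} H^n_{P_+}(R)_{j}\qquad\text{for all } j\le -n .$$
   Context: For a bigraded $P$-module $N$, $N_j=\bigoplus_i N_{(i,j)}$ is a graded $P_0$-module with $(N_j)_i=N_{(i,j)}$. $H^n_{P_+}(R)$ is local cohomology with its natural bigrading. $\operatorname{reg}$ denotes Castelnuovo-Mumford regularity over $P_0$; for a nonzero finite length graded $P_0$-module $N$ it equals $\max\{i: N_i\neq0\}$, and by convention the regularity of the zero module is $-\infty$. *)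

(* Defs.v *)
From HB Require Import structures.
From mathcomp Require Import all_boot all_order all_algebra.
From mathcomp Require Import zify ring generic_quotient ring_quotient mpoly.
From mathcomp Require Import boolp classical_sets constructive_ereal.

Set Implicit Arguments.
Unset Strict Implicit.
Unset Printing Implicit Defensive.

Import Order.TTheory GRing.Theory Num.Theory.
Local Open Scope ring_scope.
Local Open Scope quotient_scope.

Section ModuleConstructions.
Variables (A : comNzRingType) (M : lmodType A).

Definition submod (W : submodClosed M) : Type := {x : M | x \in W}.

Section Sub.
Variable W : submodClosed M.
HB.instance Definition _ := SubChoice.on (submod W).
HB.instance Definition _ := [SubChoice_isSubLmodule of submod W by <:].
End Sub.

(* W is not canonically a zmodClosed, this copy of it is. *)
Definition zmod_pred (W : submodClosed M) : {pred M} := fun x => x \in W.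
HB.instance Definition _ W := GRing.isSubmodClosed.Build A M (zmod_pred W)
  (submodClosedP W).

Definition quotmod (W : submodClosed M) : Type := Quotient.quot (zmod_pred W).

Section Quot.
Variable W : submodClosed M.
HB.instance Definition _ := GRing.Zmodule.on (quotmod W).

Definition quotmod_pi (x : M) : quotmod W := \pi_(Quotient.quot (zmod_pred W)) x.

Lemma quotmod_piP (x y : M) : quotmod_pi x = quotmod_pi y <-> x - y \in W.
Proof. by rewrite -[_ \in W]/(_ \in zmod_pred W) Quotient.idealrBE; split=> [/eqP|/eqP]. Qed.

Lemma quotmod_pi_surj (u : quotmod W) : exists x, u = quotmod_pi x.
Proof. by exists (repr (u : Quotient.quot (zmod_pred W))); rewrite /quotmod_pi reprK. Qed.

Lemma quotmod_piD x y : quotmod_pi (x + y) = quotmod_pi x + quotmod_pi y.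
Proof. by rewrite /quotmod_pi !piE. Qed.

Definition quotmod_scale (c : A) (u : quotmod W) : quotmod W :=
  quotmod_pi (c *: repr (u : Quotient.quot (zmod_pred W))).

Lemma quotmod_scaleE c x : quotmod_scale c (quotmod_pi x) = quotmod_pi (c *: x).
Proof.
apply/quotmod_piP; rewrite -scalerBr rpredZ //.
by apply/quotmod_piP; rewrite /quotmod_pi reprK.
Qed.

Fact quotmod_scaleA a b u :
  quotmod_scale a (quotmod_scale b u) = quotmod_scale (a * b) u.
Proof. by have [x ->] := quotmod_pi_surj u; rewrite !quotmod_scaleE scalerA. Qed.
Fact quotmod_scale1 : left_id 1 quotmod_scale.
Proof.
by move=> u; have [x ->] := quotmod_pi_surj u; rewrite quotmod_scaleE scale1r.
Qed.
Fact quotmod_scaleDr : right_distributive quotmod_scale +%R.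
Proof.
move=> c u v; have [x ->] := quotmod_pi_surj u; have [y ->] := quotmod_pi_surj v.
by rewrite -quotmod_piD !quotmod_scaleE scalerDr quotmod_piD.
Qed.
Fact quotmod_scaleDl u : {morph quotmod_scale^~ u : a b / a + b}.
Proof.
move=> a b; have [x ->] := quotmod_pi_surj u.
by rewrite !quotmod_scaleE scalerDl quotmod_piD.
Qed.
HB.instance Definition _ := GRing.Zmodule_isLmodule.Build A (quotmod W)
  quotmod_scaleA quotmod_scale1 quotmod_scaleDr quotmod_scaleDl.

Lemma quotmod_piZ c x : quotmod_pi (c *: x) = c *: quotmod_pi x.
Proof. by rewrite -quotmod_scaleE. Qed.

End Quot.

(* Chains W 0 < ... < W k of submodules have bounded length. *)
Definition finite_length : Prop :=
  exists l : nat, forall (k : nat) (W : nat -> submodClosed M),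
    (forall i, (i < k)%N ->
       {subset W i <= W i.+1} /\ exists2 x, x \in W i.+1 & x \notin W i) ->
    (k <= l)%N.

End ModuleConstructions.

Definition restrict_scalars (A B : comNzRingType) (phi : {rmorphism A -> B})
  (M : lmodType B) : Type := M.

Section RestrictScalars.
Variables (A B : comNzRingType) (phi : {rmorphism A -> B}) (M : lmodType B).
Local Notation restrict_scalars := (restrict_scalars phi M).

HB.instance Definition _ := GRing.Zmodule.on restrict_scalars.

Definition restrict_scale (c : A) (x : restrict_scalars) : restrict_scalars :=
  phi c *: (x : M).
Fact restrict_scaleA a b x :
  restrict_scale a (restrict_scale b x) = restrict_scale (a * b) x.
Proof. by rewrite /restrict_scale scalerA rmorphM. Qed.
Fact restrict_scale1 : left_id 1 restrict_scale.
Proof. by move=> x; rewrite /restrict_scale rmorph1 scale1r. Qed.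
Fact restrict_scaleDr : right_distributive restrict_scale +%R.
Proof. by move=> c x y; rewrite /restrict_scale scalerDr. Qed.
Fact restrict_scaleDl x : {morph restrict_scale^~ x : a b / a + b}.
Proof. by move=> a b; rewrite /restrict_scale rmorphD scalerDl. Qed.
HB.instance Definition _ := GRing.Zmodule_isLmodule.Build A restrict_scalars
  restrict_scaleA restrict_scale1 restrict_scaleDr restrict_scaleDl.

End RestrictScalars.

Section Product.
Variables (A : comNzRingType) (I : finType) (V : I -> lmodType A).

Definition prodmod : Type := {dffun forall i, V i}.
HB.instance Definition _ := Choice.on prodmod.
Implicit Types u v w : prodmod.

Definition prodmod_mk (f : forall i, V i) : prodmod := finfun f.
Definition prodmod_app u i : V i := (u : {dffun forall i, V i}) i.
Lemma prodmod_mkE f i : prodmod_app (prodmod_mk f) i = f i.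
Proof. exact: ffunE. Qed.
Lemma prodmodP u v : (forall i, prodmod_app u i = prodmod_app v i) -> u = v.
Proof. by move=> e; apply/ffunP. Qed.

Definition prodmod_add u v := prodmod_mk (fun i => prodmod_app u i + prodmod_app v i).
Definition prodmod_zero := prodmod_mk (fun i => 0).
Definition prodmod_opp u := prodmod_mk (fun i => - prodmod_app u i).
Definition prodmod_scale c u := prodmod_mk (fun i => c *: prodmod_app u i).

Fact prodmod_addA : associative prodmod_add.
Proof. by move=> u v w; apply: prodmodP => i; rewrite !prodmod_mkE addrA. Qed.
Fact prodmod_addC : commutative prodmod_add.
Proof. by move=> u v; apply: prodmodP => i; rewrite !prodmod_mkE addrC. Qed.
Fact prodmod_add0 : left_id prodmod_zero prodmod_add.
Proof. by move=> u; apply: prodmodP => i; rewrite !prodmod_mkE add0r. Qed.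
Fact prodmod_addN : left_inverse prodmod_zero prodmod_opp prodmod_add.
Proof. by move=> u; apply: prodmodP => i; rewrite !prodmod_mkE addNr. Qed.
HB.instance Definition _ := GRing.isZmodule.Build prodmod
  prodmod_addA prodmod_addC prodmod_add0 prodmod_addN.

Fact prodmod_scaleA a b u :
  prodmod_scale a (prodmod_scale b u) = prodmod_scale (a * b) u.
Proof. by apply: prodmodP => i; rewrite !prodmod_mkE scalerA. Qed.
Fact prodmod_scale1 : left_id 1 prodmod_scale.
Proof. by move=> u; apply: prodmodP => i; rewrite !prodmod_mkE scale1r. Qed.
Fact prodmod_scaleDr : right_distributive prodmod_scale +%R.
Proof. by move=> c u v; apply: prodmodP => i; rewrite !prodmod_mkE scalerDr. Qed.
Fact prodmod_scaleDl u : {morph prodmod_scale^~ u : a b / a + b}.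
Proof. by move=> a b; apply: prodmodP => i; rewrite !prodmod_mkE scalerDl. Qed.
HB.instance Definition _ := GRing.Zmodule_isLmodule.Build A prodmod
  prodmod_scaleA prodmod_scale1 prodmod_scaleDr prodmod_scaleDl.

Lemma prodmod_appD u v i : prodmod_app (u + v) i = prodmod_app u i + prodmod_app v i.
Proof. exact: prodmod_mkE. Qed.
Lemma prodmod_app0 i : prodmod_app 0 i = 0.
Proof. exact: prodmod_mkE. Qed.
Lemma prodmod_appZ c u i : prodmod_app (c *: u) i = c *: prodmod_app u i.
Proof. exact: prodmod_mkE. Qed.

End Product.

(* The localization of M at the powers of a: the pair (x, k) stands for       *)
(* the fraction x / a ^ k.                                                    *)
Section Localization.
Variables (A : comNzRingType) (M : lmodType A) (a : A).

Definition frac_equiv (u v : M * nat) : bool :=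
  `[< exists t : nat, a ^+ t *: (a ^+ v.2 *: u.1) = a ^+ t *: (a ^+ u.2 *: v.1) >].

Lemma frac_equiv_is_equiv : equiv_class_of frac_equiv.
Proof.
split=> [u|u v|v u w]; first by apply/asboolP; exists 0%N.
  by apply/idP/idP => /asboolP[t e]; apply/asboolP; exists t.
move=> /asboolP[t e] /asboolP[t' e']; apply/asboolP; exists (t + t' + v.2)%N.
move: e e'; rewrite !scalerA -!exprD => e e'.
have -> : (t + t' + v.2 + w.2 = t' + w.2 + (t + v.2))%N by lia.
rewrite exprD -scalerA e scalerA -exprD.
have -> : (t' + w.2 + (t + u.2) = t + u.2 + (t' + w.2))%N by lia.
rewrite exprD -scalerA e' scalerA -exprD.
by congr (_ ^+ _ *: _); lia.
Qed.

Canonical frac_equivRel := EquivRelPack frac_equiv_is_equiv.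
Canonical frac_encModRel := defaultEncModRel frac_equiv.

Definition localized : Type := {eq_quot frac_equiv}.
HB.instance Definition _ := Choice.on localized.

Definition frac (x : M) (k : nat) : localized := \pi_{eq_quot frac_equiv} (x, k).
Definition fnum (u : localized) : M := (repr (u : {eq_quot frac_equiv})).1.
Definition fexp (u : localized) : nat := (repr (u : {eq_quot frac_equiv})).2.

Lemma fracK u : frac (fnum u) (fexp u) = u.
Proof. by rewrite /frac /fnum /fexp -surjective_pairing reprK. Qed.

Lemma fracP x k y l : frac x k = frac y l <->
  exists t : nat, a ^+ (t + l) *: x = a ^+ (t + k) *: y.
Proof.
have -> : (frac x k = frac y l) <-> frac_equiv (x, k) (y, l).
  by split=> [/eqmodP|h]; last apply/eqmodP.
by split=> [/asboolP[t e]|[t e]]; [|apply/asboolP]; exists t;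
  move: e; rewrite !scalerA -!exprD.
Qed.

Lemma frac_fnum x k : exists t : nat,
  a ^+ (t + k) *: fnum (frac x k) = a ^+ (t + fexp (frac x k)) *: x.
Proof. by apply/fracP; rewrite fracK. Qed.

Definition loc_add (u v : localized) : localized :=
  frac (a ^+ fexp v *: fnum u + a ^+ fexp u *: fnum v) (fexp u + fexp v).
Definition loc_zero : localized := frac 0 0.
Definition loc_opp (u : localized) : localized := frac (- fnum u) (fexp u).
Definition loc_scale (c : A) (u : localized) : localized :=
  frac (c *: fnum u) (fexp u).

Lemma loc_addE x k y l :
  loc_add (frac x k) (frac y l) = frac (a ^+ l *: x + a ^+ k *: y) (k + l).
Proof.
have [t e] := frac_fnum x k; have [t' e'] := frac_fnum y l.
rewrite /loc_add; move: (fnum _) (fexp _) (fnum _) (fexp _) e e' => y' l' x' k' e e'.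
apply/fracP; exists (t + t')%N; rewrite !scalerDr !scalerA -!exprD.
congr (_ + _).
  have -> : (t + t' + (k + l) + l' = t' + l + l' + (t + k))%N by lia.
  by rewrite exprD -scalerA e scalerA -exprD; congr (_ ^+ _ *: _); lia.
have -> : (t + t' + (k + l) + k' = t + k + k' + (t' + l))%N by lia.
by rewrite exprD -scalerA e' scalerA -exprD; congr (_ ^+ _ *: _); lia.
Qed.

Lemma loc_oppE x k : loc_opp (frac x k) = frac (- x) k.
Proof.
have [t e] := frac_fnum x k; rewrite /loc_opp.
by apply/fracP; exists t; rewrite !scalerN e.
Qed.

Lemma loc_scaleE c x k : loc_scale c (frac x k) = frac (c *: x) k.
Proof.
have [t e] := frac_fnum x k; rewrite /loc_scale; apply/fracP; exists t.
by rewrite !scalerA ![_ * c]mulrC -!scalerA e.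
Qed.

Fact loc_addA : associative loc_add.
Proof.
move=> u v w; rewrite -(fracK u) -(fracK v) -(fracK w) !loc_addE addnA.
congr frac; rewrite !scalerDr !scalerA -!exprD addrA.
by congr (_ *: _ + _ *: _ + _); congr (_ ^+ _); lia.
Qed.
Fact loc_addC : commutative loc_add.
Proof. by move=> u v; rewrite /loc_add addrC addnC. Qed.
Fact loc_add0 : left_id loc_zero loc_add.
Proof.
move=> u; rewrite -(fracK u) loc_addE scaler0 add0r expr0 scale1r add0n.
by [].
Qed.
Fact loc_addN : left_inverse loc_zero loc_opp loc_add.
Proof.
move=> u; rewrite -(fracK u) loc_oppE loc_addE scalerN addNr.
by apply/fracP; exists 0%N; rewrite !scaler0.
Qed.
HB.instance Definition _ := GRing.isZmodule.Build localized
  loc_addA loc_addC loc_add0 loc_addN.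

Lemma fracD x k y l :
  frac x k + frac y l = frac (a ^+ l *: x + a ^+ k *: y) (k + l).
Proof. exact: loc_addE. Qed.

Fact loc_scaleA c d u : loc_scale c (loc_scale d u) = loc_scale (c * d) u.
Proof. by rewrite -(fracK u) !loc_scaleE scalerA. Qed.
Fact loc_scale1 : left_id 1 loc_scale.
Proof. by move=> u; rewrite -(fracK u) loc_scaleE scale1r. Qed.
Fact loc_scaleDr : right_distributive loc_scale +%R.
Proof.
move=> c u v; rewrite -(fracK u) -(fracK v) fracD !loc_scaleE fracD.
by congr frac; rewrite scalerDr !scalerA ![c * _]mulrC.
Qed.
Fact loc_scaleDl u : {morph loc_scale^~ u : c d / c + d}.
Proof.
move=> c d; rewrite -(fracK u) !loc_scaleE fracD; apply/fracP; exists 0%N.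
by rewrite -scalerDr -scalerDl !scalerA !add0n exprD mulrAC.
Qed.
HB.instance Definition _ := GRing.Zmodule_isLmodule.Build A localized
  loc_scaleA loc_scale1 loc_scaleDr loc_scaleDl.

Lemma fracZ c x k : c *: frac x k = frac (c *: x) k.
Proof. exact: loc_scaleE. Qed.
Lemma frac0 k : frac 0 k = 0.
Proof. by apply/fracP; exists 0%N; rewrite !scaler0. Qed.

Lemma loc_ind (T : localized -> Prop) : (forall x k, T (frac x k)) -> forall u, T u.
Proof. by move=> h u; rewrite -(fracK u). Qed.

End Localization.

Arguments frac {A M} a x k.

Section LocalizationMap.
Variables (A : comNzRingType) (M : lmodType A) (a b c : A).

(* The canonical map from M_a to M_b when b = c * a (see loc_mapE). *)
Definition loc_map (u : localized M a) : localized M b :=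
  frac b (c ^+ fexp u *: fnum u) (fexp u).

Hypothesis def_b : b = c * a.

Lemma loc_mapE x k : loc_map (frac a x k) = frac b (c ^+ k *: x) k.
Proof.
have [t e] := frac_fnum a x k; rewrite /loc_map.
move: (fnum _) (fexp _) e => x' k' e; apply/fracP; exists t.
rewrite !scalerA def_b !exprMn.
have -> : c ^+ (t + k) * a ^+ (t + k) * c ^+ k'
        = c ^+ (t + k + k') * a ^+ (t + k) by rewrite [in RHS]exprD mulrAC.
have -> : c ^+ (t + k') * a ^+ (t + k') * c ^+ k
        = c ^+ (t + k + k') * a ^+ (t + k').
  by rewrite mulrAC -exprD; congr (_ ^+ _ * _); lia.
by rewrite -!scalerA e.
Qed.

Lemma loc_map_linear (d : A) u v : loc_map (d *: u + v) = d *: loc_map u + loc_map v.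
Proof.
elim/loc_ind: u => x k; elim/loc_ind: v => y l.
rewrite fracZ fracD !loc_mapE fracZ fracD; congr frac.
rewrite !scalerDr !scalerA def_b !exprMn exprD.
by congr (_ *: _ + _ *: _); ring.
Qed.

End LocalizationMap.

(* The Cech complex of M with respect to s_0, ..., s_(r-1): cochains are      *)
(* indexed by all subsets S of {0, ..., r-1}, the S-component living in the   *)
(* localization of M at \prod_(i in S) s_i, and the degree p part consists of *)
(* the cochains supported on the S of cardinal p. Its cohomology in degree p  *)
(* is H^p_I(M), I being the ideal generated by the s_i.                       *)
Section Cech.
Variables (A : comNzRingType) (M : lmodType A) (r : nat) (s : 'I_r -> A).

Definition sprod (S : {set 'I_r}) : A := \prod_(i in S) s i.

Definition cochain : lmodType A :=
  prodmod (fun S : {set 'I_r} => localized M (sprod S) : lmodType A).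

Definition cech_sign (S : {set 'I_r}) (i : 'I_r) : A :=
  (-1) ^+ #|[set j in S | (j < i)%N]|.

Definition cech_d (c : cochain) : cochain :=
  prodmod_mk (fun S => \sum_(i in S) cech_sign S i *:
    loc_map (sprod S) (s i) (prodmod_app c (S :\ i)) : localized M (sprod S)).

Lemma cech_d_linear (a : A) u v : cech_d (a *: u + v) = a *: cech_d u + cech_d v.
Proof.
apply: prodmodP => S; rewrite prodmod_appD prodmod_appZ !prodmod_mkE.
rewrite scaler_sumr -big_split /=; apply: eq_bigr => i iS.
rewrite prodmod_appD prodmod_appZ loc_map_linear; last first.
  by rewrite /sprod (big_setD1 i).
by rewrite scalerDr !scalerA [a * _]mulrC.
Qed.

Definition supported (T : pred nat) (c : cochain) : Prop :=
  forall S : {set 'I_r}, ~~ T #|S| -> prodmod_app c S = 0.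

Lemma supported_linear T (a : A) u v :
  supported T u -> supported T v -> supported T (a *: u + v).
Proof.
by move=> hu hv S hS; rewrite prodmod_appD prodmod_appZ hu // hv // scaler0 addr0.
Qed.

Lemma supported0 T : supported T 0.
Proof. by move=> S _; rewrite prodmod_app0. Qed.

Lemma cech_d0 : cech_d 0 = 0.
Proof.
by have := cech_d_linear (-1) 0 0; rewrite scaler0 addr0 scaleN1r addNr.
Qed.

Definition is_cocycle (p : nat) : {pred cochain} := fun c =>
  `[< supported (pred1 p) c /\ cech_d c = 0 >].

Fact is_cocycle_submod p : submod_closed (is_cocycle p).
Proof.
split; first by apply/asboolP; split; [exact: supported0|exact: cech_d0].
move=> a u v /asboolP[hu du] /asboolP[hv dv]; apply/asboolP; split.
  exact: supported_linear.
by rewrite cech_d_linear du dv scaler0 addr0.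
Qed.
HB.instance Definition _ p := GRing.isSubmodClosed.Build A cochain (is_cocycle p)
  (is_cocycle_submod p).

Definition cocycles (p : nat) : lmodType A := submod (is_cocycle p).

(* [fun q => q.+1 == p] is empty for p = 0. *)
Definition is_coboundary (p : nat) : {pred cocycles p} := fun z =>
  `[< exists2 b, supported (fun q => q.+1 == p) b & val z = cech_d b >].

Arguments is_coboundary : clear implicits.

Fact is_coboundary_submod p : submod_closed (is_coboundary p).
Proof.
split; first by apply/asboolP; exists 0; [exact: supported0|rewrite cech_d0].
move=> a u v /asboolP[b hb eb] /asboolP[b' hb' eb']; apply/asboolP.
exists (a *: b + b'); first exact: supported_linear.
by rewrite cech_d_linear -eb -eb'.
Qed.
HB.instance Definition _ p := GRing.isSubmodClosed.Build A (cocycles p)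
  (is_coboundary p) (is_coboundary_submod p).

Definition local_cohomology (p : nat) : lmodType A := quotmod (is_coboundary p).

Definition coho_class (p : nat) (z : cocycles p) : local_cohomology p :=
  quotmod_pi (is_coboundary p) z.

(* The grading induced by a grading of M for which s_i has degree deg i. *)
Section Grading.
Variables (G : zmodType) (gr : G -> set M) (deg : 'I_r -> G).

Definition gr_localized (a : A) (e g : G) : set (localized M a) :=
  fun u => exists x k, gr (g + e *+ k) x /\ u = frac a x k.

Definition gr_cochain (g : G) : set cochain := fun c =>
  forall S : {set 'I_r},
    gr_localized (a := sprod S) (\sum_(i in S) deg i) g (prodmod_app c S).

Definition gr_cohomology (p : nat) (g : G) : set (local_cohomology p) := fun u =>
  exists2 z : cocycles p, gr_cochain g (val z) & u = coho_class z.

Lemma gr_cohomology_scale (a : A) (h : G) :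
  (forall g x, gr g x -> gr (g + h) (a *: x)) ->
  forall p g u, @gr_cohomology p g u -> gr_cohomology (g + h) (a *: u).
Proof.
move=> gra p g u [z gz ->]; exists (a *: z); last by rewrite /coho_class quotmod_piZ.
move=> S; have [x [k [gx e]]] := gz S; exists (a *: x), k.
split; first by rewrite addrAC; exact: gra.
by rewrite linearZ /= prodmod_appZ e fracZ.
Qed.

End Grading.
End Cech.

(* Castelnuovo-Mumford regularity sup {i + p | H^p_m(N)_i <> 0}, where m is   *)
(* the ideal (x_1, ..., x_m); the supremum of the empty set is -oo.           *)
Definition reg (K : fieldType) (m : nat) (N : lmodType {mpoly K[m]})
    (gr : int -> set N) : \bar int :=
  supremum -oo%E (fun e => exists (p : nat) (i : int)
      (u : local_cohomology N (fun k : 'I_m => 'X_k) p),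
    [/\ gr_cohomology gr (fun=> 1) i u, u != 0 & e = (i + p%:Z)%:E]).

Section Bigraded.
Variables (K : fieldType) (m n : nat).

Local Notation P0 := {mpoly K[m]}.
Local Notation P := {mpoly {mpoly K[m]}[n]}.

Definition bihomogeneous (d e : nat) (f : P) : Prop :=
  f \is e.-homog /\ forall mon : 'X_{1.. n}, f@_mon \is d.-homog.

(* P is the regular module P^o here; P_d = 0 when d has a negative entry. *)
Definition gr_P (d : int * int) : set P^o := fun p =>
  p = 0 \/ exists a b : nat, d = (a%:Z, b%:Z) /\ bihomogeneous a b p.

Definition in_fP (f : P) : {pred P^o} := fun p =>
  `[< exists q : P, p = f * q >].

Fact in_fP_submod f : submod_closed (in_fP f).
Proof.
split; first by apply/asboolP; exists 0; rewrite mulr0.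
move=> a u v /asboolP[q ->] /asboolP[q' ->]; apply/asboolP.
by exists (a * q + q'); rewrite mulrDr mulrCA.
Qed.
HB.instance Definition _ f := GRing.isSubmodClosed.Build P P^o (in_fP f)
  (in_fP_submod f).

Variable f : P.

Definition Rmod : lmodType P := quotmod (in_fP f).

Definition gr_R (d : int * int) : set Rmod := fun u =>
  exists2 p, gr_P d p & u = quotmod_pi (in_fP f) p.

(* H^n_{P_+}(R), as a P-module and as a P_0-module *)
Definition HnR : lmodType P := local_cohomology Rmod (fun k : 'I_n => 'X_k) n.
Definition HnR0 : lmodType P0 := restrict_scalars (@mpolyC n P0) HnR.

Definition gr_HnR (d : int * int) : set HnR := 
  gr_cohomology gr_R (fun=> (0, 1)) d.

Definition in_HnR_row (j : int) : {pred HnR0} := fun u =>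
  `[< exists2 l : seq HnR0,
        (forall v, v \in l -> exists i, gr_HnR (i, j) v) & u = \sum_(v <- l) v >].

Lemma gr_HnR_scale (c : K) (mon : 'X_{1.. m}) i j (u : HnR) : gr_HnR (i, j) u ->
  gr_HnR (i + (mdeg mon)%:Z, j) ((c *: 'X_[mon] : P0)%:MP *: u).
Proof.
have -> : (i + (mdeg mon)%:Z, j) = (i, j) + ((mdeg mon)%:Z, 0).
  by congr pair; rewrite /= addr0.
apply: gr_cohomology_scale => d x [p gp ->].
exists ((c *: 'X_[mon] : P0)%:MP *: p); last by rewrite quotmod_piZ.
case: gp => [->|[a [b [-> [hb ha]]]]]; first by left; rewrite scaler0.
right; exists (a + mdeg mon)%N, b; split.
  by congr pair; rewrite /= ?addr0 ?PoszD.
rewrite /GRing.scale /= mul_mpolyC; split; first exact: dhomogZ.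
move=> mon'; rewrite mcoeffZ addnC; apply: dhomogM; last exact: ha.
by apply: dhomogZ; rewrite dhomogX.
Qed.

Fact in_HnR_row_submod j : submod_closed (in_HnR_row j).
Proof.
split; first by apply/asboolP; exists [::]; rewrite ?big_nil.
move=> a u v /asboolP[l hl ->] /asboolP[l' hl' ->]; apply/asboolP.
exists ([seq ((a@_mon *: 'X_[mon] : P0) *: w) | mon <- msupp a, w <- l] ++ l').
  move=> w; rewrite mem_cat => /orP[|]; last exact: hl'.
  case/allpairsP=> -[mon w'] /= [_ /hl[i gi] ->].
  by exists (i + (mdeg mon)%:Z); exact: gr_HnR_scale.
rewrite big_cat /= big_allpairs_dep /=; congr (_ + _).
under [RHS]eq_bigr => mon _ do rewrite -scaler_sumr.
rewrite -scaler_suml; congr (_ *: _); rewrite -raddf_sum /=.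
by congr (_%:MP); exact: mpolyE.
Qed.
HB.instance Definition _ j := GRing.isSubmodClosed.Build P0 HnR0 (in_HnR_row j)
  (in_HnR_row_submod j).

(* The graded P_0-module H^n_{P_+}(R)_j, sum of the components of bidegree    *)
(* (i, j).                                                                    *)
Definition HnR_row (j : int) : lmodType P0 := submod (in_HnR_row j).

Definition gr_HnR_row (j i : int) : set (HnR_row j) := fun u => gr_HnR (i, j) (val u).

End Bigraded.

Arguments gr_HnR_row {K m n} f j i _.

(* Main.v *)
From HB Require Import structures.
Require Import Defs.
From mathcomp Require Import all_boot all_order all_algebra.
From mathcomp Require Import zify mpoly.
From mathcomp Require Import boolp classical_sets constructive_ereal.
Import Order.TTheory GRing.Theory Num.Theory.
Set Implicit Arguments.
Unset Strict Implicit.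
Unset Printing Implicit Defensive.
Local Open Scope ring_scope.

(** The top local cohomology [H^n_{P_+}] is right exact and vanishes on modules
    killed by some [y_i], so multiplication by [y_i] is surjective on
    [H^n_{P_+}(R)]. Concretely, the top Cech cochains are the fractions
    [u / Y ^ k] with [Y] the product of all the [y_i]; all of them are cocycles,
    and [u / Y ^ k] is [y_i] times the fraction obtained by dividing it by [y_i]
    ([top_class_mul]). Since [y_i] has bidegree [(0, 1)], a nonzero element of
    bidegree [(i, j)] comes from a nonzero element of bidegree [(i, j - 1)]: the
    set of [x]-degrees in which the row [j] is nonzero can only grow when [j]
    decreases ([HnR_row_degrees_lower]).

    It remains to see that the regularity of a row [N] of finite length, defined
    through local cohomology with respect to [x_1, ..., x_m], is the supremum of
    these degrees. If every element of [N] is killed by a power of each [x_k],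
    all the localizations in the Cech complex vanish but the one indexed by the
    empty set, which is [N] itself: [H^0] is [N], and the higher cohomology is
    zero ([reg_torsion]).

    For the torsion, finite length makes the chain of the cyclic submodules
    generated by the [x_k ^ t u] stationary, so [w := x_k ^ t u] satisfies
    [w = c x_k w] for some [c]. If [u] is homogeneous, so is [w], and comparing
    the components of lowest degree gives [w = 0]. As a row is only known as a
    set of sums of homogeneous classes, this comparison is made on polynomials:
    [p / Y ^ k] is the zero class iff, for some [t], [Y ^ t p] belongs to the
    ideal generated by [f] and the [y_i ^ (k + t)] ([HnR_frac_eq0]), and this
    ideal contains the [x]-homogeneous components of its members
    ([gr_HnR_fixed_eq0]). *)

Local Notation frac := Defs.frac.

(** * Suprema of sets of integers *)

(** [supremum] takes its default value on a set without supremum, so suprema can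
    only be compared once they are known to exist. *)
Lemma int_set_has_supremum (D : set int) :
  (D !=set0 -> supremums [set i%:E | i in D] !=set0)%classic.
Proof.
move=> [d Dd].
have [[b ubD]|unbounded] := pselect (exists b, forall i, D i -> i <= b).
  (* The greatest element of [D] is [b - k] for the least possible [k]. *)
  pose T k := `[< D (b - k%:Z) >].
  have exT : exists k, T k.
    exists `|b - d|%N; apply/asboolP.
    by have := ubD d Dd => ledb; have -> : b - `|(b - d)%R|%N%:Z = d by lia.
  case: (ex_minnP exT) => k /asboolP Dk mink.
  exists (b - k%:Z)%:E; split=> [_ [i Di <-]|y ub]; last first.
    by apply: ub; exists (b - k%:Z).
  rewrite lee_fin leNgt; apply/negP => lti; have leib := ubD i Di.
  have /mink : T `|b - i|%N.
    by apply/asboolP; have -> : b - `|(b - i)%R|%N%:Z = i by lia.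
  lia.
exists +oo%E; split=> [y _|y ub]; first exact: leey.
case: y ub => [b||] ub //; last by have := ub _ (ex_intro2 _ _ d Dd erefl).
case: unbounded; exists b => i Di.
by have := ub _ (ex_intro2 _ _ i Di erefl); rewrite lee_fin.
Qed.

Lemma supremum_int_le (D E : set int) : (D `<=` E)%classic ->
  (supremum -oo%E [set i%:E | i in D]%classic
     <= supremum -oo%E [set i%:E | i in E]%classic)%E.
Proof.
move=> DE; have [[d Dd]|noD] := pselect (D !=set0)%classic; last first.
  rewrite (_ : [set i%:E | i in D]%classic = set0) ?supremum0 ?leNye //.
  by apply/seteqP; split=> // y [i Di _]; case: noD; exists i.
have sup_spec F : F d -> supremums [set i%:E | i in F]%classic
                            (supremum -oo%E [set i%:E | i in F]%classic).
  move=> Fd; rewrite /supremum ifF; last first.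
    by apply/negbTE/set0P; exists d%:E, d.
  case: xgetP => [y _ //|none].
  have [y supy] : (supremums [set i%:E | i in F] !=set0)%classic.
    by apply: int_set_has_supremum; exists d.
  by case: (none y).
have [_ lubD] := sup_spec D Dd; have [ubE _] := sup_spec E (DE d Dd).
by apply: lubD => _ [i Di <-]; apply: ubE; exists i => //; exact: DE.
Qed.

(** * Regularity of torsion modules *)

Lemma quotmod_pi0 (A : comNzRingType) (M : lmodType A) (W : submodClosed M) :
  quotmod_pi W 0 = 0.
Proof. by rewrite -(scale0r (0 : M)) quotmod_piZ scale0r. Qed.

Section Torsion.
Variables (A : comNzRingType) (M : lmodType A).

Lemma localized_torsion_eq0 (a : A) :
  (forall x : M, exists t, a ^+ t *: x = 0) -> forall u : localized M a, u = 0.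
Proof.
move=> tors u; elim/loc_ind: u => x k; have [t xt] := tors x.
rewrite -(frac0 M a k); apply/fracP; exists t.
by rewrite scaler0 exprD mulrC -scalerA xt scaler0.
Qed.

Variables (r : nat) (s : 'I_r -> A).
Local Notation torsion := (forall i (x : M), exists t, s i ^+ t *: x = 0).

Lemma localized_sprod_torsion_eq0 (S : {set 'I_r}) : torsion -> S != finset.set0 ->
  forall u : localized M (sprod s S), u = 0.
Proof.
move=> tors /set0Pn[i iS]; apply: localized_torsion_eq0 => x.
have [t xt] := tors i x; exists t.
by rewrite /sprod (big_setD1 i) //= exprMn mulrC -scalerA xt scaler0.
Qed.

Lemma coho_class_eq0 p (z : cocycles M s p) :
  coho_class z = 0 <-> exists2 b, supported (fun q => q.+1 == p) b & val z = cech_d b.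
Proof.
rewrite -(quotmod_pi0 (@is_coboundary A M r s p)) quotmod_piP subr0.
by split=> [/asboolP|h]; last exact/asboolP.
Qed.

Lemma cocycleP p (z : cocycles M s p) : supported (pred1 p) (val z).
Proof. by case: z => z /= /asboolP[]. Qed.

Variables (G : zmodType) (gr : G -> set M) (deg : 'I_r -> G).
Hypothesis gr0 : forall g, gr g 0.

(** For a torsion module only the localization at the empty product survives in
    the Cech complex, so the cohomology is the module itself, in degree 0. *)
Lemma gr_cohomology_torsion p g : torsion ->
  (exists2 u, gr_cohomology (s := s) (p := p) gr deg g u & u != 0)
  <-> p = 0 /\ exists2 x, gr g x & x != 0.
Proof.
move=> tors; split=> [[_ [z gz ->]]|[-> [x gx x0]]].
  case: p z gz => [|p] z gz.
    have [x [k [gx zx]]] := gz finset.set0.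
    rewrite big_set0 mul0rn addr0 in gx.
    move=> z0; split=> //; exists x => //; apply: contra_neq z0 => x0.
    apply/coho_class_eq0; exists 0; first exact: supported0.
    rewrite cech_d0; apply: prodmodP => S; rewrite prodmod_app0.
    have [->|S0] := eqVneq S finset.set0; first by rewrite zx x0 frac0.
    by apply: cocycleP; rewrite /= cards_eq0.
  case/eqP; apply/coho_class_eq0; exists 0; first exact: supported0.
  rewrite cech_d0; apply: prodmodP => S; rewrite prodmod_app0.
  have [->|S0] := eqVneq S finset.set0; last exact: localized_sprod_torsion_eq0.
  by apply: cocycleP; rewrite /= cards0.
pose c : cochain M s :=
  prodmod_mk (fun S =>
    frac _ (if S == finset.set0 then x else 0) 0 : localized M (sprod s S)).
have zc : c \in is_cocycle (s := s) 0.
  apply/asboolP; split=> [S /=|].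
    by rewrite cards_eq0 prodmod_mkE => /negPf ->; rewrite frac0.
  apply: prodmodP => S; rewrite prodmod_app0.
  have [->|S0] := eqVneq S finset.set0; last exact: localized_sprod_torsion_eq0.
  by rewrite prodmod_mkE big_set0.
pose z : cocycles M s 0 := Sub c zc.
exists (coho_class z).
  exists z => // S; rewrite SubK; exists (if S == finset.set0 then x else 0), 0.
  by rewrite mulr0n addr0 prodmod_mkE; case: ifP.
apply/eqP => /coho_class_eq0[b bsupp]; rewrite SubK => cb.
have b0 : b = 0 by apply: prodmodP => S; rewrite prodmod_app0 bsupp.
have := congr1 (fun c => prodmod_app c finset.set0) cb.
rewrite /= b0 cech_d0 prodmod_app0 prodmod_mkE eqxx -(frac0 M _ 0).
case/fracP=> t; rewrite /sprod big_set0 !expr1n !scale1r => xe.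
by rewrite xe eqxx in x0.
Qed.

End Torsion.

Lemma reg_torsion (K : fieldType) m (N : lmodType {mpoly K[m]}) (gr : int -> set N) :
  (forall i, gr i 0) ->
  (forall k (x : N), exists t, ('X_k : {mpoly K[m]}) ^+ t *: x = 0) ->
  reg gr =
  supremum -oo%E [set i%:E | i in [set i | exists2 x, gr i x & x != 0]]%classic.
Proof.
move=> gr0 tors; congr supremum; apply/seteqP; split=> e.
  case=> p [i [u [gu u0 ->]]].
  have [-> gx] :=
    (gr_cohomology_torsion (fun=> 1) gr0 p i tors).1 (ex_intro2 _ _ u gu u0).
  by exists i => //; rewrite addr0.
case=> i gx <-.
have [u gu u0] :=
  (gr_cohomology_torsion (fun=> 1) gr0 0 i tors).2 (conj erefl gx).
by exists 0, i, u; rewrite addr0.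
Qed.

(** * Top local cohomology *)

Section Top.
Variables (A : comNzRingType) (M : lmodType A) (r : nat) (s : 'I_r -> A).
Local Notation Y := (sprod s [set: 'I_r]).

Lemma card_lt_setT (S : {set 'I_r}) : S != [set: 'I_r] -> (#|S| < r)%N.
Proof.
rewrite -properT => /proper_card.
by rewrite cardsT card_ord.
Qed.

Definition top_cochain (x : M) (k : nat) : cochain M s :=
  prodmod_mk (fun S =>
    frac _ (if S == [set: 'I_r] then x else 0) k : localized M (sprod s S)).

Lemma top_cochain_cocycle x k : top_cochain x k \in is_cocycle (s := s) r.
Proof.
apply/asboolP; split=> [S /= Sr|].
  rewrite prodmod_mkE; case: (S =P _) Sr => [->|_]; last by rewrite frac0.
  by rewrite cardsT card_ord eqxx.
apply: prodmodP => S; rewrite prodmod_app0 prodmod_mkE big1 // => i iS.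
rewrite prodmod_mkE (_ : (S :\ i == _) = false) ?frac0.
  by rewrite -(frac0 M _ 0) loc_mapE ?scaler0 ?frac0 ?scaler0 // /sprod (big_setD1 i).
by apply/eqP => /setP/(_ i); rewrite !inE eqxx.
Qed.

Definition top_cocycle x k : cocycles M s r :=
  Sub (top_cochain x k) (top_cochain_cocycle x k).

Definition top_class x k : local_cohomology M s r := coho_class (top_cocycle x k).

Lemma cocycle_topE (z : cocycles M s r) x k :
  prodmod_app (val z) [set: 'I_r] = frac _ x k -> z = top_cocycle x k.
Proof.
move=> zT; apply: val_inj; rewrite SubK; apply: prodmodP => S.
rewrite prodmod_mkE; case: eqP => [->//|/eqP/card_lt_setT ltS].
by rewrite frac0; apply: cocycleP; rewrite /= ltn_eqF.
Qed.

Lemma top_classZ a x k : a *: top_class x k = top_class (a *: x) k.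
Proof.
rewrite /top_class /coho_class -quotmod_piZ; congr (quotmod_pi _ _).
by apply: cocycle_topE; rewrite linearZ /= prodmod_appZ prodmod_mkE eqxx fracZ.
Qed.

(** Every top cochain is a cocycle, so a cocycle can be divided by [s i] by putting
    one more power of [Y] in the denominator. This is what makes multiplication
    by [s i] surjective on the top local cohomology. *)
Lemma top_class_mul x k i :
  s i *: top_class ((\prod_(j | j != i) s j) *: x) k.+1 = top_class x k.
Proof.
rewrite top_classZ scalerA; congr coho_class; symmetry; apply: cocycle_topE.
rewrite prodmod_mkE eqxx; apply/fracP; exists 0%N.
rewrite /= !add0n (_ : s i * _ = Y) ?scalerA -?exprSr //.
rewrite /sprod (big_setD1 i) ?inE //=; congr (_ * _).
by apply: eq_bigl => j; rewrite !inE andbT.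
Qed.

(** The top local cohomology is the direct limit of the quotients of [M] by
    [s_0 ^ k M + ... + s_(r-1) ^ k M], with multiplication by [Y] as transition
    maps: the class of [x / Y ^ k] is zero iff some transition map kills [x]. *)
Lemma top_class_eq0 x k : top_class x k = 0 <->
  exists t (q : 'I_r -> M), Y ^+ t *: x = \sum_i s i ^+ (k + t) *: q i.
Proof.
have sprodD1 (S : {set 'I_r}) i : i \in S -> sprod s S = s i * sprod s (S :\ i).
  by move=> iS; rewrite /sprod (big_setD1 i).
rewrite /top_class coho_class_eq0; split=> [[b _ xb]|[t [q xq]]].
  have {xb} := congr1 (fun c => prodmod_app c [set: 'I_r]) xb.
  rewrite SubK !prodmod_mkE eqxx => xb.
  (* The components of [b] are brought to the common denominator [Y ^ l]. *)
  have [l [q]] : exists l (q : 'I_r -> M),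
      frac Y x k = frac Y (\sum_i s i ^+ l *: q i) l.
    rewrite {}xb.
    elim/big_ind: _ => [|u v [l [q ->]] [l' [q' ->]]|i _].
    - by exists 0%N, (fun=> 0); rewrite big1 ?frac0 // => i _; rewrite scaler0.
    - exists (l + l')%N, (fun i => sprod s ([set: 'I_r] :\ i) ^+ l' *: q i
                          + sprod s ([set: 'I_r] :\ i) ^+ l *: q' i).
      rewrite fracD !scaler_sumr -big_split /=; congr frac; apply: eq_bigr => i _.
      rewrite scalerDr !scalerA [in LHS](sprodD1 _ i) ?inE // !exprMn.
      by congr (_ *: _ + _ *: _); rewrite mulrAC -exprD // addnC.
    elim/loc_ind: (prodmod_app b _) => y l.
    exists l, (fun j => if j == i then cech_sign A [set: 'I_r] i *: y else 0).
    rewrite (loc_mapE (sprodD1 _ i (finset.in_setT i))) fracZ; congr frac.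
    rewrite (bigD1 i) //= eqxx big1 ?addr0 ?scalerA 1?mulrC // => j /negPf ->.
    by rewrite scaler0.
  case/fracP=> t e.
  exists (t + l)%N, (fun i => sprod s ([set: 'I_r] :\ i) ^+ (t + k) *: q i).
  rewrite e scaler_sumr; apply: eq_bigr => i _.
  rewrite !scalerA (sprodD1 _ i) ?inE // exprMn mulrAC -exprD.
  by congr (_ ^+ _ * _ *: _); lia.
(* The sum has one term if [S] is the complement of a point, none otherwise. *)
exists (prodmod_mk (fun S =>
  frac _ (\sum_(i | S == [set: 'I_r] :\ i) cech_sign A [set: 'I_r] i *: q i) (k + t)
    : localized M (sprod s S))).
  move=> S Sr; rewrite prodmod_mkE big_pred0 ?frac0 // => i.
  apply: contraNF Sr => /eqP ->.
  by have := cardsD1 i [set: 'I_r]; rewrite cardsT card_ord inE add1n => <-.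
rewrite SubK; apply: prodmodP => S; rewrite !prodmod_mkE.
case: eqP => [->|ST].
  transitivity (frac Y (Y ^+ t *: x) (k + t)).
    by apply/fracP; exists 0%N; rewrite !add0n scalerA exprD.
  have -> : frac Y (Y ^+ t *: x) (k + t)
      = \sum_i frac Y (s i ^+ (k + t) *: q i) (k + t).
    rewrite xq; apply: (big_morph (fun y => frac Y y (k + t))) => [y y'|].
      rewrite fracD -scalerDr; apply/fracP; exists 0%N.
      by rewrite !add0n scalerA exprD.
    exact: frac0.
  apply: eq_big => i; first by rewrite inE.
  move=> _; rewrite prodmod_mkE (loc_mapE (sprodD1 _ i (finset.in_setT i))) fracZ.
  congr frac.
  rewrite (big_pred1 i) => [|j /=].
    by rewrite !scalerA mulrC -mulrA -expr2 sqrr_sign mulr1.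
  apply/eqP/eqP => [/setP/(_ i)|->//].
  by rewrite !inE eqxx andbT /=; case: eqP.
rewrite frac0 big1 // => i iS; rewrite prodmod_mkE big_pred0 => [|j].
  by rewrite (loc_mapE (sprodD1 _ i iS)) scaler0 frac0 scaler0.
apply/negP => /eqP e; case: ST; apply/setP=> l; rewrite inE.
have [->//|li] := eqVneq l i.
have /setP/(_ i) := e; rewrite !inE eqxx /= andbT => /esym/negbFE/eqP ij.
by have /setP/(_ l) := e; rewrite !inE -ij li.
Qed.

Variables (G : zmodType) (gr : G -> set M) (deg : 'I_r -> G).

Lemma gr_top_classP g u : (forall h, gr h 0) ->
  gr_cohomology gr deg g u <->
  exists x k, gr (g + (\sum_i deg i) *+ k) x /\ u = top_class x k.
Proof.
move=> gr0; split=> [[z gz ->]|[x [k [gx ->]]]].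
  have [x [k [gx zx]]] := gz [set: 'I_r]; exists x, k; split.
    by move: gx; congr (gr (_ + _ *+ _) _); apply: eq_bigl => i; rewrite inE.
  by congr coho_class; exact: cocycle_topE.
exists (top_cocycle x k) => // S.
exists (if S == [set: 'I_r] then x else 0), k; rewrite SubK prodmod_mkE; split=> //.
case: eqP => // ->; move: gx; congr (gr (_ + _ *+ _) _).
by apply: eq_bigl => i; rewrite inE.
Qed.

End Top.

(** * Finite length *)

Lemma submod_val_eq0 (A : comNzRingType) (M : lmodType A) (W : submodClosed M)
  (u : submod W) : val u = 0 <-> u = 0.
Proof. by split=> [u0|->]; [apply: val_inj; rewrite u0 raddf0|rewrite raddf0]. Qed.

Section FiniteLength.
Variables (A : comNzRingType) (M : lmodType A).

Definition cyclic_submod (u : M) : {pred M} := fun x => `[< exists c, x = c *: u >].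

Fact cyclic_submod_closed u : submod_closed (cyclic_submod u).
Proof.
split; first by apply/asboolP; exists 0; rewrite scale0r.
move=> a x y /asboolP[c ->] /asboolP[d ->]; apply/asboolP.
by exists (a * c + d); rewrite scalerDl scalerA.
Qed.
HB.instance Definition _ u :=
  GRing.isSubmodClosed.Build A M (cyclic_submod u) (cyclic_submod_closed u).

Lemma finite_length_stabilizes (a : A) (u : M) :
  finite_length M -> exists t c, a ^+ t *: u = c *: (a ^+ t.+1 *: u).
Proof.
case=> l chain; apply: contrapT => never.
pose W i : submodClosed M := cyclic_submod (a ^+ (l.+1 - i) *: u).
have := chain l.+1 W; rewrite ltnn => /(_ _)/negP; case=> // i ltil.
rewrite /W subSS subSn //; set t := (l - i)%N.
split=> [_ /asboolP[c ->]|].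
  by apply/asboolP; exists (c * a); rewrite exprS -!scalerA.
exists (a ^+ t *: u); first by apply/asboolP; exists 1; rewrite scale1r.
by apply/asboolP => -[c tc]; apply: never; exists t, c.
Qed.

End FiniteLength.

(** * Homogeneous components in the variables [x] *)

Section Polynomials.
Variables (K : fieldType) (m n : nat).
Local Notation P0 := {mpoly K[m]}.
Local Notation P := {mpoly {mpoly K[m]}[n]}.

Lemma pihomogM d e (p q : P0) : p \is d.-homog ->
  pihomog mdeg e (p * q) = if (d <= e)%N then p * pihomog mdeg (e - d) q else 0.
Proof.
move=> hp; rewrite [q]mpolyE mulr_sumr !raddf_sum.
case: ifP => [lede|ltde]; rewrite ?mulr_sumr; [apply: eq_bigr|apply: big1] => k _.
  rewrite /= -scalerAr !linearZ /= -scalerAr; congr (_ *: _).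
  have hpk : p * 'X_[k] \is (d + mdeg k).-homog.
    by apply: dhomogM; rewrite ?dhomogX.
  rewrite pihomogX; case: eqP => [ek|ek].
    by apply: pihomog_dE; rewrite ek subnKC // in hpk.
  rewrite mulr0 (pihomog_ne0 _ hpk) //.
  by apply/eqP => ed; apply: ek; rewrite -ed addKn.
rewrite /= -scalerAr linearZ /= (pihomog_ne0 (d := d + mdeg k)) ?scaler0 //.
  by apply/eqP => ek; move: ltde; rewrite -ek leq_addr.
by apply: dhomogM; rewrite ?dhomogX.
Qed.

Definition xhomog (d : nat) (p : P) : Prop := forall k, p@_k \is d.-homog.

Definition xcomp (d : nat) (p : P) : P := map_mpoly (pihomog mdeg d) p.

Lemma xcompE d p k : (xcomp d p)@_k = pihomog mdeg d p@_k.
Proof. exact: mcoeff_map_mpoly. Qed.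

Lemma xcompD d p q : xcomp d (p + q) = xcomp d p + xcomp d q.
Proof. exact: raddfD. Qed.

Lemma xcomp_sum d I (r : seq I) (F : I -> P) :
  xcomp d (\sum_(i <- r) F i) = \sum_(i <- r) xcomp d (F i).
Proof. exact: raddf_sum. Qed.

Lemma xcompM d e p q : xhomog d p ->
  xcomp e (p * q) = if (d <= e)%N then p * xcomp (e - d) q else 0.
Proof.
move=> hp; apply/mpolyP => k; rewrite xcompE mcoeffM raddf_sum /=.
case: ifP => lede; last first.
  by rewrite mcoeff0 big1 // => l _; rewrite (pihomogM _ _ (hp _)) lede.
by rewrite mcoeffM; apply: eq_bigr => l _; rewrite (pihomogM _ _ (hp _)) lede xcompE.
Qed.

Lemma xhomogM d e p q : xhomog d p -> xhomog e q -> xhomog (d + e) (p * q).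
Proof.
by move=> hp hq k; rewrite mcoeffM; apply: rpred_sum => l _; apply: dhomogM.
Qed.

Lemma xhomog1 : xhomog 0 1.
Proof. by move=> k; rewrite mcoeff1; case: eqP => _; rewrite ?dhomog1 ?rpred0. Qed.

Lemma xhomogX i : xhomog 0 'X_i.
Proof. by move=> k; rewrite mcoeffX; case: eqP => _; rewrite ?dhomog1 ?rpred0. Qed.

Lemma xhomogXn p t : xhomog 0 p -> xhomog 0 (p ^+ t).
Proof.
move=> hp; elim: t => [|t IH]; first by rewrite expr0; exact: xhomog1.
by rewrite exprS; exact: (@xhomogM 0 0).
Qed.

Lemma xhomog_sprod (S : {set 'I_n}) : xhomog 0 (sprod (fun i => 'X_i) S).
Proof.
rewrite /sprod; elim/big_ind: _ => [|p q|i _].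
- exact: xhomog1.
- exact: (@xhomogM 0 0).
- exact: xhomogX.
Qed.

(** * The module [H^n_{P_+}(R)] *)

Lemma gr_P0 d : gr_P d (0 : P^o).
Proof. by left. Qed.

Lemma gr_P_mulX d (p : P^o) i : gr_P d p -> gr_P (d + (0, 1)) ('X_i *: p).
Proof.
case=> [->|[a [b [-> [hb ha]]]]]; first by left; rewrite scaler0.
right; exists a, b.+1; split; first by congr pair; rewrite /= ?addr0 // -PoszD addn1.
split; first by rewrite -[b.+1]add1n; apply: dhomogM => //; rewrite dhomogX /= mdeg1.
by apply: (@xhomogM 0 a); [exact: xhomogX|exact: ha].
Qed.

Variable f : P.

Lemma gr_R0 d : gr_R d (0 : Rmod f).
Proof. by exists 0; [exact: gr_P0|rewrite quotmod_pi0]. Qed.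

Lemma gr_R_mulX d (u : Rmod f) (T : pred 'I_n) : gr_R d u ->
  gr_R (d + \sum_(i | T i) (0, 1)) ((\prod_(i | T i) 'X_i) *: u).
Proof.
case=> p gp ->; exists ((\prod_(i | T i) 'X_i) *: p); last by rewrite quotmod_piZ.
elim: (index_enum _) => [|i r IH]; first by rewrite !big_nil addr0 scale1r.
rewrite !big_cons; case: (T i) => //.
by rewrite addrCA addrC -scalerA; exact: gr_P_mulX.
Qed.

Local Notation piR := (@quotmod_pi P P^o (in_fP f)).
Local Notation y := (fun i : 'I_n => 'X_i : P).
Local Notation Y := (sprod y [set: 'I_n]).

Definition HnR_frac (p : P) (k : nat) : HnR f :=
  @top_class P (Rmod f) n y (piR p) k.

Lemma HnR_fracZ (a p : P) k : a *: HnR_frac p k = HnR_frac (a * p) k.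
Proof. by rewrite /HnR_frac top_classZ -quotmod_piZ. Qed.

Lemma gr_HnRP d (u : HnR f) : gr_HnR d u <->
  exists p k, gr_P (d + (\sum_(i < n) (0, 1)) *+ k) p /\ u = HnR_frac p k.
Proof.
split=> [/(gr_top_classP _ _ _ gr_R0)[x [k [[p gp ->] ->]]]|[p [k [gp ->]]]].
  by exists p, k.
apply/(gr_top_classP _ _ _ gr_R0); exists (piR p), k; split=> //.
by exists p.
Qed.

(** [H^n_{P_+}(R)] is the direct limit of the [P / (f, y_0 ^ k, ..., y_(n-1) ^ k)],
    which turns questions on classes into ideal membership in [P]. *)
Lemma HnR_frac_eq0 (p : P) k : HnR_frac p k = 0 <->
  exists t w (q : 'I_n -> P), Y ^+ t * p = f * w + \sum_i 'X_i ^+ (k + t) * q i.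
Proof.
have pi_sum t (q : 'I_n -> P) : piR (\sum_i 'X_i ^+ t * q i)
    = \sum_i 'X_i ^+ t *: piR (q i).
  rewrite (big_morph _ (@quotmod_piD _ _ _) (quotmod_pi0 _)).
  by apply: eq_bigr => i _; rewrite -quotmod_piZ.
rewrite /HnR_frac top_class_eq0; split=> [[t [q]]|[t [w [q e]]]].
  have [q' qE] := choice (fun i => quotmod_pi_surj (q i)).
  rewrite (eq_bigr (fun i => 'X_i ^+ (k + t) *: piR (q' i))); last first.
    by move=> i _; rewrite qE.
  rewrite -pi_sum -quotmod_piZ => /quotmod_piP/asboolP[w /eqP].
  by rewrite subr_eq => /eqP e; exists t, w, q'.
exists t, (fun i => piR (q i)); rewrite -pi_sum -quotmod_piZ.
by apply/quotmod_piP/asboolP; exists w; rewrite /GRing.scale /= e addrK.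
Qed.

Hypothesis hf : exists a b : nat, bihomogeneous a b f.

(** A graded form of Nakayama's lemma: the equation [(1 - h) u = 0] has [u] as its
    component of lowest degree. Taking it on representatives is legitimate
    because [f] and the powers of the [y_i] are homogeneous in [x]. *)
Lemma gr_HnR_fixed_eq0 d (u : HnR f) (h : P0) : pihomog mdeg 0 h = 0 ->
  gr_HnR d u -> u = h%:MP *: u -> u = 0.
Proof.
case: hf => a [b [_ fa]] h0 /gr_HnRP[p [k [gp ->]]] hu.
have [->|[c [e [_ [_ pc]]]]] := gp.
  apply/HnR_frac_eq0; exists 0, 0, (fun=> 0).
  by rewrite !mulr0 big1 ?addr0 // => i _; rewrite mulr0.
have : HnR_frac (p * (1 - h%:MP)) k = 0.
  by rewrite mulrC -HnR_fracZ scalerBl scale1r -hu subrr.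
case/HnR_frac_eq0=> t [w [q /(congr1 (xcomp c))]].
have Yt := xhomogXn t (xhomog_sprod [set: 'I_n]).
rewrite (xcompM _ _ Yt) subn0 (xcompM _ _ pc) leqnn subnn.
have -> : xcomp 0 (1 - h%:MP) = 1.
  apply/mpolyP=> l; rewrite xcompE mcoeffB mcoeff1 mcoeffC raddfB /=.
  case: eqP => _; rewrite ?mulr0 ?mulr1 ?h0 ?oppr0 ?raddf0 ?addr0 //.
  by rewrite pihomog_dE ?dhomog1.
rewrite mulr1 leq0n xcompD (xcompM _ _ fa) xcomp_sum => e'.
apply/HnR_frac_eq0.
exists t, (if (a <= c)%N then xcomp (c - a) w else 0), (fun i => xcomp c (q i)).
rewrite e'; congr (_ + _); first by case: ifP; rewrite ?mulr0.
apply: eq_bigr => i _; have Xt := xhomogXn (k + t) (xhomogX i).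
by rewrite (xcompM _ _ Xt) subn0.
Qed.

(** * The rows of [H^n_{P_+}(R)] *)

Lemma gr_HnR_mulX_surj d (u : HnR f) i : gr_HnR d u ->
  exists2 v, gr_HnR (d - (0, 1)) v & u = ('X_i : P) *: v.
Proof.
case/(gr_top_classP _ _ _ gr_R0)=> [x [k [gx ->]]].
exists (top_class y ((\prod_(j | j != i) 'X_j) *: x) k.+1); last first.
  by rewrite (top_class_mul _ _ _ i).
apply/(gr_top_classP _ _ _ gr_R0).
exists ((\prod_(j | j != i) 'X_j) *: x), k.+1; split=> //.
have := gr_R_mulX (fun j => j != i) gx; congr (gr_R _ _).
by rewrite mulrS addrA [in X in _ = X + _](bigD1 i) //= [in RHS]addrA subrK addrAC.
Qed.

Lemma gr_HnR0 d : gr_HnR d (0 : HnR f).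
Proof.
apply/gr_HnRP; exists 0, 0; split; first exact: gr_P0.
apply/esym/HnR_frac_eq0; exists 0, 0, (fun=> 0).
by rewrite !mulr0 add0r big1 // => i _; rewrite mulr0.
Qed.

Lemma gr_HnR_row_lift j i (v : HnR f) : gr_HnR (i, j) v ->
  exists2 u : HnR_row f j, gr_HnR_row f j i u & val u = v.
Proof.
move=> gv.
have vj : (v : HnR0 f) \in in_HnR_row (f := f) j.
  apply/asboolP; exists [:: v : HnR0 f]; last by rewrite big_seq1.
  by move=> w; rewrite inE => /eqP ->; exists i.
by exists (exist _ v vj).
Qed.

(** An element of the row [j] is [y_0 v] with [v] in the row [j - 1], of the same
    degree in [x]; if [y_0 v] is nonzero, so is [v]. *)
Lemma HnR_row_degrees_lower j i : (0 < n)%N ->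
  (exists2 u, gr_HnR_row f j i u & u != 0) ->
  exists2 u, gr_HnR_row f (j - 1) i u & u != 0.
Proof.
move=> n0 [u gu u0]; have [v gv uv] := gr_HnR_mulX_surj (Ordinal n0) gu.
rewrite (_ : (i, j) - (0, 1) = (i, j - 1)) in gv; last by congr pair; rewrite /= subr0.
have [w gw wv] := gr_HnR_row_lift gv; exists w => //.
apply/eqP => /submod_val_eq0 w0; case/eqP: u0; apply/submod_val_eq0.
by rewrite uv -wv w0 scaler0.
Qed.

(** Homogeneous elements come first, because the comparison of the components of
    lowest degree applies to them; a general element is a finite sum of these. *)
Lemma HnR_row_torsion j k (u : HnR_row f j) :
  finite_length (HnR_row f j) -> exists t, ('X_k : P0) ^+ t *: u = 0.
Proof.
move=> fl.
have hom_tors v i : gr_HnR_row f j i v -> exists t, ('X_k : P0) ^+ t *: v = 0.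
  move=> gv; have [t [c e]] := finite_length_stabilizes 'X_k v fl; exists t.
  rewrite exprS -scalerA scalerA in e.
  have gt : gr_HnR_row f j (i + (mdeg (U_(k) *+ t))%:Z) ('X_k ^+ t *: v).
    have := gr_HnR_scale 1 (U_(k) *+ t)%MM gv; rewrite scale1r -mpolyXn.
    by rewrite /gr_HnR_row linearZ.
  apply: val_inj; apply: (gr_HnR_fixed_eq0 (h := c * 'X_k) _ gt).
    by rewrite mulrC (@pihomogM 1) // dhomogX /= mdeg1.
  by rewrite {1}e linearZ.
have /asboolP[l hl] := valP u; elim: l u hl => [|v l IH] u hl ul.
  exists 0; rewrite scale1r; apply: val_inj.
  by rewrite ul big_nil raddf0.
have [i gv] := hl v (mem_head _ _).
have [v' gv' vv'] := gr_HnR_row_lift gv; have [t' et'] := hom_tors v' i gv'.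
have [||t et] := IH (u - v'); first by move=> w wl; apply: hl; rewrite inE wl orbT.
  by rewrite raddfB /= ul big_cons vv' addrC addKr.
exists (t + t')%N; rewrite -(subrK v' u) scalerDr exprD.
by rewrite -[X in _ + X]scalerA et' scaler0 addr0 mulrC -scalerA et scaler0.
Qed.

Lemma reg_HnR_row j : finite_length (HnR_row f j) ->
  reg (gr_HnR_row f j) = supremum -oo%E
    [set i%:E | i in [set i | exists2 u, gr_HnR_row f j i u & u != 0]]%classic.
Proof.
move=> fl; apply: reg_torsion => [i|k u]; first exact: gr_HnR0.
exact: HnR_row_torsion.
Qed.

End Polynomials.

Theorem corollary3p4 (K : fieldType) (m n : nat) (hn : (0 < n)%N)
    (f : {mpoly {mpoly K[m]}[n]})
    (hf : exists a b : nat, bihomogeneous a b f)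
    (hfin : forall j : int, finite_length (HnR_row f j)) :
  forall j : int, j <= - n%:Z ->
    (reg (gr_HnR_row f (j - 1)) >= reg (gr_HnR_row f j))%E.
Proof.
move=> j _; rewrite !reg_HnR_row //; apply: supremum_int_le => i.
exact: HnR_row_degrees_lower.
Qed.
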